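(* $\mathsf{RCA}_0$ does not prove the statement: every partial order with countably many initial intervals has no infinite antichains.
   Context: A partial order $(P,\preceq)$ has $P\subseteq\mathbb{N}$. An antichain is a set of pairwise incomparable elements. An initial interval of $P$ is $I\subseteq P$ with $x\preceq y\in I\Rightarrow x\in I$. $P$ has countably many initial intervals if there is a sequence $\{I_n:n\in\mathbb{N}\}$ (coded by one set) such that every initial interval of $P$ equals some $I_n$. *)

(* Defs.v *)
From Stdlib Require Import List.
Import ListNotations.

(** * The language L2 of second-order arithmetic

    Numbers and sets have separate de Bruijn indices: [All1]/[Ex1] bind number
    variables, [All2]/[Ex2] bind set variables. There are no set terms besides
    variables, and equality is primitive for numbers only. *)

Inductive term : Type :=
| Var (n : nat)
| Zero
| One
| Plus (s t : term)
| Times (s t : term).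

Inductive form : Type :=
| EqF (s t : term)
| LtF (s t : term)
| Mem (t : term) (X : nat)
| Bot
| Imp (p q : form)
| And (p q : form)
| Or (p q : form)
| All1 (p : form)
| Ex1 (p : form)
| All2 (p : form)
| Ex2 (p : form).

Definition Not (p : form) : form := Imp p Bot.
Definition Iff (p q : form) : form := And (Imp p q) (Imp q p).

Declare Scope l2_scope.
Delimit Scope l2_scope with l2.
Bind Scope l2_scope with term form.

Infix "+" := Plus : l2_scope.
Infix "*" := Times : l2_scope.
Infix "≐" := EqF (at level 70, no associativity) : l2_scope.
Infix "<" := LtF : l2_scope.
Notation "t 'ϵ' X" := (Mem t X) (at level 70, no associativity) : l2_scope.
Notation "~ p" := (Not p) : l2_scope.
Infix "/\" := And : l2_scope.
Infix "\/" := Or : l2_scope.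
Infix "⟹" := Imp (at level 90, right associativity) : l2_scope.
Infix "⟺" := Iff (at level 95, no associativity) : l2_scope.

Local Open Scope l2_scope.

(** ** Substitution *)

Fixpoint tsub (s : nat -> term) (t : term) : term :=
  match t with
  | Var n => s n
  | Zero => Zero
  | One => One
  | Plus a b => Plus (tsub s a) (tsub s b)
  | Times a b => Times (tsub s a) (tsub s b)
  end.

Definition tshift (t : term) : term := tsub (fun n => Var (S n)) t.

Definition up1 (s : nat -> term) (n : nat) : term :=
  match n with 0 => Var 0 | S k => tshift (s k) end.

Definition up2 (r : nat -> nat) (n : nat) : nat :=
  match n with 0 => 0 | S k => S (r k) end.

Fixpoint sub1 (s : nat -> term) (p : form) : form :=
  match p with
  | EqF a b => EqF (tsub s a) (tsub s b)
  | LtF a b => LtF (tsub s a) (tsub s b)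
  | Mem a X => Mem (tsub s a) X
  | Bot => Bot
  | Imp p q => Imp (sub1 s p) (sub1 s q)
  | And p q => And (sub1 s p) (sub1 s q)
  | Or p q => Or (sub1 s p) (sub1 s q)
  | All1 p => All1 (sub1 (up1 s) p)
  | Ex1 p => Ex1 (sub1 (up1 s) p)
  | All2 p => All2 (sub1 s p)
  | Ex2 p => Ex2 (sub1 s p)
  end.

Fixpoint ren2 (r : nat -> nat) (p : form) : form :=
  match p with
  | EqF a b => EqF a b
  | LtF a b => LtF a b
  | Mem a X => Mem a (r X)
  | Bot => Bot
  | Imp p q => Imp (ren2 r p) (ren2 r q)
  | And p q => And (ren2 r p) (ren2 r q)
  | Or p q => Or (ren2 r p) (ren2 r q)
  | All1 p => All1 (ren2 r p)
  | Ex1 p => Ex1 (ren2 r p)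
  | All2 p => All2 (ren2 (up2 r) p)
  | Ex2 p => Ex2 (ren2 (up2 r) p)
  end.

Definition shift1 (p : form) : form := sub1 (fun n => Var (S n)) p.
Definition shift2 (p : form) : form := ren2 S p.

Definition inst1 (t : term) (p : form) : form :=
  sub1 (fun n => match n with 0 => t | S k => Var k end) p.
Definition inst2 (Y : nat) (p : form) : form :=
  ren2 (fun n => match n with 0 => Y | S k => k end) p.

(** * Provability: classical two-sorted natural deduction with equality

    [T] is a set of axioms and [G] the list of open hypotheses. The quantifier
    rules shift [G] but not [T], so a formula of [T] with free variables is used
    as its universal closure. *)

Inductive derives (T : form -> Prop) : list form -> form -> Prop :=
| d_ax G p : T p -> derives T G p
| d_hyp G p : List.In p G -> derives T G p
| d_impI G p q : derives T (p :: G) q -> derives T G (Imp p q)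
| d_impE G p q : derives T G (Imp p q) -> derives T G p -> derives T G q
| d_andI G p q : derives T G p -> derives T G q -> derives T G (And p q)
| d_andE1 G p q : derives T G (And p q) -> derives T G p
| d_andE2 G p q : derives T G (And p q) -> derives T G q
| d_orI1 G p q : derives T G p -> derives T G (Or p q)
| d_orI2 G p q : derives T G q -> derives T G (Or p q)
| d_orE G p q r : derives T G (Or p q) ->
    derives T (p :: G) r -> derives T (q :: G) r -> derives T G r
| d_raa G p : derives T (Not p :: G) Bot -> derives T G p
| d_all1I G p : derives T (map shift1 G) p -> derives T G (All1 p)
| d_all1E G p t : derives T G (All1 p) -> derives T G (inst1 t p)
| d_ex1I G p t : derives T G (inst1 t p) -> derives T G (Ex1 p)
| d_ex1E G p q : derives T G (Ex1 p) ->
    derives T (p :: map shift1 G) (shift1 q) -> derives T G q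
| d_all2I G p : derives T (map shift2 G) p -> derives T G (All2 p)
| d_all2E G p Y : derives T G (All2 p) -> derives T G (inst2 Y p)
| d_ex2I G p Y : derives T G (inst2 Y p) -> derives T G (Ex2 p)
| d_ex2E G p q : derives T G (Ex2 p) ->
    derives T (p :: map shift2 G) (shift2 q) -> derives T G q
| d_eqI G t : derives T G (EqF t t)
| d_eqE G s t p : derives T G (EqF s t) ->
    derives T G (inst1 s p) -> derives T G (inst1 t p).

Definition proves (T : form -> Prop) (p : form) : Prop := derives T [] p.

(** * The theory RCA_0 *)

(** Set parameters are allowed; in a bounded quantifier the bound [t] lives
    outside the binder, hence [tshift]. *)
Inductive Delta00 : form -> Prop :=
| D0_eq s t : Delta00 (EqF s t)
| D0_lt s t : Delta00 (LtF s t)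
| D0_mem t X : Delta00 (Mem t X)
| D0_bot : Delta00 Bot
| D0_imp p q : Delta00 p -> Delta00 q -> Delta00 (Imp p q)
| D0_and p q : Delta00 p -> Delta00 q -> Delta00 (And p q)
| D0_or p q : Delta00 p -> Delta00 q -> Delta00 (Or p q)
| D0_all t p : Delta00 p -> Delta00 (All1 (Var 0 < tshift t ⟹ p))
| D0_ex t p : Delta00 p -> Delta00 (Ex1 (Var 0 < tshift t /\ p)).

Inductive Sigma01 : form -> Prop :=
| Sigma01_ex p : Delta00 p -> Sigma01 (Ex1 p).

Inductive Pi01 : form -> Prop :=
| Pi01_all p : Delta00 p -> Pi01 (All1 p).

(** [p] with its number variable [0], say n, replaced by n + 1. *)
Definition succ_inst (p : form) : form :=
  sub1 (fun n => match n with 0 => Var 0 + One | S k => Var (S k) end) p.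

Definition induction_ax (p : form) : form :=
  inst1 Zero p /\ All1 (p ⟹ succ_inst p) ⟹ All1 p.

(** [shift2 p] expresses that the set being defined is not free in [p]. *)
Definition comprehension_ax (p q : form) : form :=
  All1 (p ⟺ q) ⟹ Ex2 (All1 (Var 0 ϵ 0 ⟺ shift2 p)).

Inductive RCA0 : form -> Prop :=
| ax_succ_neq0 : RCA0 (~ (Var 0 + One ≐ Zero))
| ax_succ_inj : RCA0 (Var 0 + One ≐ Var 1 + One ⟹ Var 0 ≐ Var 1)
| ax_add0 : RCA0 (Var 0 + Zero ≐ Var 0)
| ax_addS : RCA0 (Var 0 + (Var 1 + One) ≐ (Var 0 + Var 1) + One)
| ax_mul0 : RCA0 (Var 0 * Zero ≐ Zero)
| ax_mulS : RCA0 (Var 0 * (Var 1 + One) ≐ Var 0 * Var 1 + Var 0)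
| ax_lt0 : RCA0 (~ (Var 0 < Zero))
| ax_ltS : RCA0 (Var 0 < Var 1 + One ⟺ Var 0 < Var 1 \/ Var 0 ≐ Var 1)
| ax_ind p : Sigma01 p -> RCA0 (induction_ax p)
| ax_comp p q : Sigma01 p -> Pi01 q -> RCA0 (comprehension_ax p q).

(** * Partial orders in L2

    [P], [L], [I], [X], [A] below are indices of set variables; they are
    incremented when passing under a set quantifier. *)

(** (i,j) = (i+j)^2 + i, injective on pairs provably in RCA_0. *)
Definition code_pair (i j : term) : term := (i + j) * (i + j) + i.

(** [L] is the set of codes of pairs (x,y) with x ≼ y. *)
Definition prec (L : nat) (x y : term) : form := code_pair x y ϵ L.

Definition subset (X Y : nat) : form := All1 (Var 0 ϵ X ⟹ Var 0 ϵ Y).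

Definition partial_order (P L : nat) : form :=
  All1 (Var 0 ϵ L ⟹
    Ex1 (Ex1 (Var 1 ϵ P /\ Var 0 ϵ P /\ Var 2 ≐ code_pair (Var 1) (Var 0))))
  /\ All1 (Var 0 ϵ P ⟹ prec L (Var 0) (Var 0))
  /\ All1 (All1 (prec L (Var 1) (Var 0) /\ prec L (Var 0) (Var 1) ⟹
       Var 1 ≐ Var 0))
  /\ All1 (All1 (All1 (prec L (Var 2) (Var 1) /\ prec L (Var 1) (Var 0) ⟹
       prec L (Var 2) (Var 0)))).

Definition initial_interval (P L I : nat) : form :=
  subset I P /\ All1 (All1 (prec L (Var 1) (Var 0) /\ Var 0 ϵ I ⟹ Var 1 ϵ I)).

(** The set [X] codes the sequence of sets X_n = {m : (m,n) ∈ X}. *)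
Definition countably_many_initial_intervals (P L : nat) : form :=
  Ex2 (All2 (initial_interval (S (S P)) (S (S L)) 0 ⟹
    Ex1 (All1 (Var 0 ϵ 0 ⟺ code_pair (Var 0) (Var 1) ϵ 1)))).

Definition antichain (P L A : nat) : form :=
  subset A P /\
  All1 (All1 (Var 1 ϵ A /\ Var 0 ϵ A /\ ~ (Var 1 ≐ Var 0) ⟹
    ~ prec L (Var 1) (Var 0) /\ ~ prec L (Var 0) (Var 1))).

Definition infinite (A : nat) : form := All1 (Ex1 (Var 1 < Var 0 /\ Var 0 ϵ A)).

Definition no_infinite_antichain (P L : nat) : form :=
  ~ Ex2 (antichain (S P) (S L) 0 /\ infinite 0).

Definition countable_intervals_imply_no_infinite_antichain : form :=
  All2 (All2 (partial_order 1 0 /\ countably_many_initial_intervals 1 0 ⟹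
    no_infinite_antichain 1 0)).

(* Main.v *)
(** An omega-model of RCA_0 in which the statement fails: its sets are those
    computable from a suitable partial order on N, constructed by finite extensions
    so that the even numbers are an antichain. To handle the e-th computation,
    introduce a new odd element b, incomparable to all even numbers. If some
    extension of the finite order built so far makes the computation converge at b,
    adopt it; then put all later elements below b if the computation accepts b,
    above b if it rejects b. If no extension does, keep later even numbers
    incomparable to b, so that the computation stays undefined at b. Hence every
    initial interval in the model is finite or cofinite, and all finite and
    cofinite sets are listed by one computable sequence. *)

From Stdlib Require Import List Arith Lia Bool Classical ClassicalEpsilon.
From Stdlib Require Cantor.
Require Import Defs.
Import ListNotations.

(** * Tarski semantics over the standard numbers *)

Definition nset := nat -> Prop.
Definition full : nset := fun _ => True.

Fixpoint teval (l : list nat) (t : term) : nat :=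
  match t with
  | Var n => nth n l 0
  | Zero => 0
  | One => 1
  | Plus a b => teval l a + teval l b
  | Times a b => teval l a * teval l b
  end.

(* Number variables beyond the list [l] denote [0], set variables beyond [r]
   denote [full]. *)
Fixpoint sat (U : nset -> Prop) (l : list nat) (r : list nset) (p : form) : Prop :=
  match p with
  | EqF a b => teval l a = teval l b
  | LtF a b => teval l a < teval l b
  | Mem a X => nth X r full (teval l a)
  | Bot => False
  | Imp p q => sat U l r p -> sat U l r q
  | And p q => sat U l r p /\ sat U l r q
  | Or p q => sat U l r p \/ sat U l r q
  | All1 p => forall n, sat U (n :: l) r p
  | Ex1 p => exists n, sat U (n :: l) r p
  | All2 p => forall X, U X -> sat U l (X :: r) p
  | Ex2 p => exists X, U X /\ sat U l (X :: r) p
  end.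

(** * Substitution lemmas and soundness *)

Lemma teval_tsub (s : nat -> term) (l l' : list nat) (t : term) :
  (forall n, nth n l' 0 = teval l (s n)) -> teval l (tsub s t) = teval l' t.
Proof. intros H; induction t; simpl; congruence. Qed.

Lemma teval_tshift (n : nat) (l : list nat) (t : term) :
  teval (n :: l) (tshift t) = teval l t.
Proof. now apply teval_tsub. Qed.

Lemma sat_sub1 (U : nset -> Prop) (p : form) : forall s l l' r,
  (forall n, nth n l' 0 = teval l (s n)) ->
  (sat U l r (sub1 s p) <-> sat U l' r p).
Proof.
  assert (Hup : forall s l l', (forall n, nth n l' 0 = teval l (s n)) ->
    forall m n, nth n (m :: l') 0 = teval (m :: l) (up1 s n)).
  { intros s l l' H m [|n]; simpl; [reflexivity|].
    now rewrite teval_tshift. }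
  induction p; intros s0 l l' r H; simpl;
    rewrite ?(teval_tsub s0 l l') by assumption; try reflexivity.
  - rewrite (IHp1 s0 l l' r H), (IHp2 s0 l l' r H); tauto.
  - rewrite (IHp1 s0 l l' r H), (IHp2 s0 l l' r H); tauto.
  - rewrite (IHp1 s0 l l' r H), (IHp2 s0 l l' r H); tauto.
  - split; intros A m; specialize (A m);
      apply (IHp (up1 s0) (m :: l) (m :: l') r (Hup _ _ _ H m)); assumption.
  - split; intros [m A]; exists m;
      apply (IHp (up1 s0) (m :: l) (m :: l') r (Hup _ _ _ H m)); assumption.
  - split; intros A X HX; apply (IHp s0 l l' (X :: r) H); auto.
  - split; intros (X & HX & A); exists X; split; auto;
      apply (IHp s0 l l' (X :: r) H); auto.
Qed.

Lemma sat_ren2 (U : nset -> Prop) (p : form) : forall f l r r',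
  (forall k, nth k r' full = nth (f k) r full) ->
  (sat U l r (ren2 f p) <-> sat U l r' p).
Proof.
  assert (Hup : forall f (r r' : list nset),
    (forall k, nth k r' full = nth (f k) r full) ->
    forall X k, nth k (X :: r') full = nth (up2 f k) (X :: r) full).
  { intros f r r' H X [|k]; simpl; auto. }
  induction p; intros f l r r' H; simpl; try reflexivity.
  - now rewrite H.
  - rewrite (IHp1 f l r r' H), (IHp2 f l r r' H); tauto.
  - rewrite (IHp1 f l r r' H), (IHp2 f l r r' H); tauto.
  - rewrite (IHp1 f l r r' H), (IHp2 f l r r' H); tauto.
  - split; intros A m; specialize (A m);
      apply (IHp f (m :: l) r r' H); assumption.
  - split; intros [m A]; exists m;
      apply (IHp f (m :: l) r r' H); assumption.
  - split; intros A X HX; specialize (A X HX);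
      apply (IHp (up2 f) l (X :: r) (X :: r') (Hup _ _ _ H X)); assumption.
  - split; intros (X & HX & A); exists X; (split; [assumption|]);
      apply (IHp (up2 f) l (X :: r) (X :: r') (Hup _ _ _ H X)); assumption.
Qed.

Lemma sat_inst1 U t p l r : sat U l r (inst1 t p) <-> sat U (teval l t :: l) r p.
Proof. apply sat_sub1; intros [|n]; reflexivity. Qed.

Lemma sat_shift1 U p n l r : sat U (n :: l) r (shift1 p) <-> sat U l r p.
Proof. apply sat_sub1; reflexivity. Qed.

Lemma sat_inst2 U Y p l r : sat U l r (inst2 Y p) <-> sat U l (nth Y r full :: r) p.
Proof. apply sat_ren2; intros [|n]; reflexivity. Qed.

Lemma sat_shift2 U p X l r : sat U l (X :: r) (shift2 p) <-> sat U l r p.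
Proof. apply sat_ren2; reflexivity. Qed.

Lemma Forall_shift1 U G n l r :
  Forall (sat U l r) G -> Forall (sat U (n :: l) r) (map shift1 G).
Proof.
  intros H; apply Forall_map; revert H; apply Forall_impl.
  intros p; apply sat_shift1.
Qed.

Lemma Forall_shift2 U G X l r :
  Forall (sat U l r) G -> Forall (sat U l (X :: r)) (map shift2 G).
Proof.
  intros H; apply Forall_map; revert H; apply Forall_impl.
  intros p; apply sat_shift2.
Qed.

(** [E] constrains set environments as whole lists. Its closure under [nth] covers the default
    [full] too, which matters when a set quantifier is instantiated by an index beyond the list. *)
Theorem soundness (U : nset -> Prop) (E : list nset -> Prop) (T : form -> Prop) :
  (forall r X, E r -> U X -> E (X :: r)) ->
  (forall r k, E r -> U (nth k r full)) ->
  (forall p l r, T p -> E r -> sat U l r p) ->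
  forall G p, derives T G p ->
  forall l e, E e -> Forall (sat U l e) G -> sat U l e p.
Proof.
  intros Econs Enth HT G p D; induction D; intros l e Hr HG.
  - now apply HT.
  - rewrite Forall_forall in HG; now apply HG.
  - simpl; intros Hp; apply IHD; auto.
  - exact (IHD1 l e Hr HG (IHD2 l e Hr HG)).
  - split; auto.
  - apply (IHD l e Hr HG).
  - apply (IHD l e Hr HG).
  - left; auto.
  - right; auto.
  - destruct (IHD1 l e Hr HG); [apply IHD2 | apply IHD3]; auto.
  - apply NNPP; intros Hn; apply (IHD l e Hr); constructor; auto.
  - intros n; apply IHD; auto using Forall_shift1.
  - apply sat_inst1, (IHD l e Hr HG).
  - exists (teval l t); apply sat_inst1; auto.
  - destruct (IHD1 l e Hr HG) as [n Hn].
    apply (sat_shift1 U q n), IHD2; auto using Forall_shift1.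
  - intros X HX; apply IHD; auto using Forall_shift2.
  - apply sat_inst2, (IHD l e Hr HG); auto.
  - exists (nth Y e full); split; auto; apply sat_inst2; auto.
  - destruct (IHD1 l e Hr HG) as (X & HX & Hp).
    apply (sat_shift2 U q X), IHD2; auto using Forall_shift2.
  - reflexivity.
  - apply sat_inst1; generalize (IHD2 l e Hr HG); rewrite sat_inst1.
    now rewrite (IHD1 l e Hr HG : teval l s = teval l t).
Qed.

(** There are no set quantifiers to evaluate, so truth in the model agrees with [holds]. *)
Lemma sat_Delta00_indep U U' p : Delta00 p ->
  forall l r, sat U l r p <-> sat U' l r p.
Proof.
  intros D; induction D; intros l r; simpl; try reflexivity.
  - rewrite (IHD1 l r), (IHD2 l r); tauto.
  - rewrite (IHD1 l r), (IHD2 l r); tauto.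
  - rewrite (IHD1 l r), (IHD2 l r); tauto.
  - split; intros A n Hn; apply IHD; auto.
  - split; intros (n & Hn & A); exists n; split; auto; apply IHD; auto.
Qed.

(** * Sets computable from a relation *)

Definition rel := nat -> nat -> Prop.

Definition agree (N : nat) (R R' : rel) : Prop :=
  forall x y, x < N -> y < N -> (R x y <-> R' x y).

Lemma agree_le N M R R' : N <= M -> agree M R R' -> agree N R R'.
Proof. intros H A x y Hx Hy; apply A; lia. Qed.

Lemma agree_trans N R R' R'' : agree N R R' -> agree N R' R'' -> agree N R R''.
Proof. intros A B x y Hx Hy; rewrite (A x y Hx Hy); auto. Qed.

Definition npr (i j : nat) : nat := (i + j) * (i + j) + i.

(** Since (i+j)^2 <= [npr i j] < (i+j+1)^2, the value determines i+j. *)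
Lemma npr_inj i j i' j' : npr i j = npr i' j' -> i = i' /\ j = j'.
Proof.
  unfold npr; intros H.
  assert (i + j = i' + j') as E by nia.
  rewrite E in H; lia.
Qed.

Definition relset (R : rel) : nset := fun z => exists x y, z = npr x y /\ R x y.

Lemma relset_npr R x y : relset R (npr x y) <-> R x y.
Proof.
  split; [|intros H; now exists x, y].
  intros (x' & y' & E & H); apply npr_inj in E; destruct E; congruence.
Qed.

(* The binary expansion of [n], from bit 1 on, lists the elements of the n-th set
   or, if bit 0 is set, of its complement: all finite and cofinite sets occur. *)
Definition fincofin (n : nat) : nset :=
  fun x => xorb (Nat.testbit n (S x)) (Nat.testbit n 0) = true.

Lemma bounded_comprehension (N : nat) (Q : nset) :
  exists n, forall i, Nat.testbit n i = true <-> i < N /\ Q i.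
Proof.
  induction N as [|N [n Hn]].
  - exists 0; intros i; rewrite Nat.bits_0; split; [discriminate | lia].
  - destruct (classic (Q N)) as [HQ|HQ].
    + exists (Nat.setbit n N); intros i; rewrite Nat.setbit_iff, Hn.
      split; [intros [->|[? ?]]; split; auto with arith|].
      intros [H1 H2]; destruct (Nat.eq_dec N i); [auto | right; split; auto; lia].
    + exists n; intros i; rewrite Hn; split; intros [H1 H2]; split; auto; try lia.
      destruct (Nat.eq_dec i N); [congruence | lia].
Qed.

Lemma eventually_constant_fincofin (N : nat) (v : bool) (I : nset) :
  (forall y, N <= y -> (I y <-> v = true)) ->
  exists n, forall x, I x <-> fincofin n x.
Proof.
  intros HI.
  (* Bit 0 stores the limit value [v]; bit x+1 marks the [x] at which [I] deviates from it, all of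
     them below [N]. *)
  destruct (bounded_comprehension (S N)
    (fun i => match i with 0 => v = true | S x => ~ (I x <-> v = true) end)) as [n Hn].
  exists n; intros x; unfold fincofin.
  assert (E0 : Nat.testbit n 0 = v).
  { apply eq_true_iff_eq; rewrite (Hn 0); split; [tauto | intros; split; auto; lia]. }
  rewrite E0; clear E0; specialize (HI x).
  destruct (Nat.testbit n (S x)) eqn:E.
  - destruct (proj1 (Hn (S x)) E) as [_ Q].
    destruct (classic (I x)), v; simpl; intuition discriminate.
  - assert (Q : I x <-> v = true); [|destruct v; simpl; exact Q].
    destruct (le_lt_dec N x); [auto|].
    apply NNPP; intros Q; rewrite (proj2 (Hn (S x))) in E; [discriminate|].
    split; [lia | exact Q].
Qed.

(** The order, its domain, the antichain and the list of candidate initial intervals are built in,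
    which saves defining them by formulas. *)
Definition base (R : rel) (k : nat) : nset :=
  match k with
  | 0 => relset R
  | 1 => full
  | 2 => fun x => Nat.even x = true
  | _ => fun z => exists x n, z = npr x n /\ fincofin n x
  end.

(* A code describes a finite list of sets: [Push p q l c d] adds to the list [d]
   the set {x : p(x)}, where p (Sigma01) and q (Pi01) are equivalent formulas with
   number parameters [l] and set parameters [c]. *)
Inductive code : Type :=
| Nil
| Base (k : nat) (d : code)
| Push (p q : form) (l : list nat) (c d : code).

(** Good codes contain no set quantifiers, so codes can be evaluated before the sets of the model
    are fixed. *)
Definition holds := sat (fun _ => True).

Fixpoint sem (R : rel) (c : code) : list nset :=
  match c with
  | Nil => []
  | Base k d => base R k :: sem R d
  | Push p q l c d => (fun x => holds (x :: l) (sem R c) p) :: sem R d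
  end.

(** Two formulas may be equivalent over one order and not over another: goodness plays the part of
    totality of a computation with oracle [R]. *)
Fixpoint good (R : rel) (c : code) : Prop :=
  match c with
  | Nil => True
  | Base k d => good R d
  | Push p q l c d => Sigma01 p /\ Pi01 q /\
      (forall x, holds (x :: l) (sem R c) p <-> holds (x :: l) (sem R c) q) /\
      good R c /\ good R d
  end.

Definition get (k : nat) (R : rel) (c : code) : nset := nth k (sem R c) full.

(** Continuity of [Q] at [R] within [G], for the topology given by finite restrictions of
    relations. *)
Definition locally (R : rel) (G : rel -> Prop) (Q : rel -> Prop) : Prop :=
  exists N, forall R', agree N R R' -> G R' -> (Q R' <-> Q R).

Lemma locally_bounded (R : rel) (G : rel -> Prop) (Q : nat -> rel -> Prop) (m : nat) :
  (forall n, locally R G (Q n)) ->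
  exists N, forall R', agree N R R' -> G R' -> forall n, n < m -> (Q n R' <-> Q n R).
Proof.
  intros H; induction m as [|m [N HN]].
  - exists 0; intros; lia.
  - destruct (H m) as [M HM]; exists (max N M); intros R' A g n Hn.
    destruct (Nat.eq_dec n m) as [->|].
    + apply HM; auto; apply agree_le with (2 := A); lia.
    + apply HN; auto; [|lia]; apply agree_le with (2 := A); lia.
Qed.

(** A bounded formula consults only finitely many membership facts, so the maximum of their bounds
    suffices. *)
Lemma Delta00_locally (R : rel) (G : rel -> Prop) (r : rel -> list nset) :
  (forall k x, locally R G (fun R' => nth k (r R') full x)) ->
  forall p, Delta00 p -> forall l, locally R G (fun R' => holds l (r R') p).
Proof.
  intros Hr p D; induction D; intros l; unfold holds in *; simpl;
    try (exists 0; reflexivity).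
  - apply Hr.
  - destruct (IHD1 l) as [N HN], (IHD2 l) as [M HM]; exists (max N M);
      intros R' A g; rewrite HN, HM by (auto; apply agree_le with (2 := A); lia); tauto.
  - destruct (IHD1 l) as [N HN], (IHD2 l) as [M HM]; exists (max N M);
      intros R' A g; rewrite HN, HM by (auto; apply agree_le with (2 := A); lia); tauto.
  - destruct (IHD1 l) as [N HN], (IHD2 l) as [M HM]; exists (max N M);
      intros R' A g; rewrite HN, HM by (auto; apply agree_le with (2 := A); lia); tauto.
  - destruct (locally_bounded R G _ (teval l t) (fun n => IHD (n :: l))) as [N HN].
    exists N; intros R' A g; specialize (HN R' A g).
    split; intros B n Hn; apply HN; auto; rewrite teval_tshift in Hn; auto.
  - destruct (locally_bounded R G _ (teval l t) (fun n => IHD (n :: l))) as [N HN].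
    exists N; intros R' A g; specialize (HN R' A g).
    split; intros (n & Hn & B); exists n; split; auto; apply HN; auto;
      rewrite teval_tshift in Hn; auto.
Qed.

(* Finite use: a true Sigma01 fact persists near R through its witness, a false one
   through the witness against the equivalent Pi01 fact. *)
Lemma get_locally (c : code) : forall R, good R c ->
  forall k x, locally R (fun R' => good R' c) (fun R' => get k R' c x).
Proof.
  unfold get; induction c as [|b d IHd|p q l c IHc d IHd]; intros R g k x.
  - exists 0; destruct k; reflexivity.
  - destruct k as [|k]; [|apply (IHd R g k x)].
    destruct b as [|[|[|b]]]; try (exists 0; reflexivity).
    (* Both components of a pair are at most its code. *)
    exists (S x); intros R' A _; simpl.
    split; intros (i & j & E & H); exists i, j; (split; [assumption|]);
      apply (A i j); auto; unfold npr in E; nia.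
  - destruct g as (Hp & Hq & E & gc & gd).
    destruct k as [|k].
    + destruct Hp as [p Hp], Hq as [q Hq]; simpl.
      destruct (classic (holds (x :: l) (sem R c) (Ex1 p))) as [T|F].
      * destruct T as [w Hw].
        destruct (Delta00_locally R (fun R' => good R' c) (fun R' => sem R' c)
          (fun k x => IHc R gc k x) p Hp (w :: x :: l)) as [N HN].
        exists N; intros R' A (_ & _ & _ & gc' & _).
        split; intros _; exists w; [exact Hw | apply (HN R' A gc'), Hw].
      * assert (F' := F); rewrite E in F'.
        apply not_all_ex_not in F'; destruct F' as [w Hw].
        destruct (Delta00_locally R (fun R' => good R' c) (fun R' => sem R' c)
          (fun k x => IHc R gc k x) q Hq (w :: x :: l)) as [N HN].
        exists N; intros R' A (_ & _ & E' & gc' & _).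
        split; [|contradiction]; intros H; exfalso.
        apply E' in H; apply Hw, (HN R' A gc'), H.
    + destruct (IHd R gd k x) as [N HN]; exists N.
      intros R' A (_ & _ & _ & _ & gd'); exact (HN R' A gd').
Qed.

(** * Codes are countable *)

Definition npair (a b : nat) : nat := Cantor.to_nat (a, b).

Lemma npair_inj a b a' b' : npair a b = npair a' b' -> a = a' /\ b = b'.
Proof.
  unfold npair; intros H; apply Cantor.to_nat_inj in H; now injection H.
Qed.

#[local] Opaque npair.

Fixpoint term_enc (t : term) : nat :=
  match t with
  | Var n => npair 0 n
  | Zero => npair 1 0
  | One => npair 2 0
  | Plus a b => npair 3 (npair (term_enc a) (term_enc b))
  | Times a b => npair 4 (npair (term_enc a) (term_enc b))
  end.

Fixpoint form_enc (p : form) : nat :=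
  match p with
  | EqF a b => npair 0 (npair (term_enc a) (term_enc b))
  | LtF a b => npair 1 (npair (term_enc a) (term_enc b))
  | Mem a X => npair 2 (npair (term_enc a) X)
  | Bot => npair 3 0
  | Imp p q => npair 4 (npair (form_enc p) (form_enc q))
  | And p q => npair 5 (npair (form_enc p) (form_enc q))
  | Or p q => npair 6 (npair (form_enc p) (form_enc q))
  | All1 p => npair 7 (form_enc p)
  | Ex1 p => npair 8 (form_enc p)
  | All2 p => npair 9 (form_enc p)
  | Ex2 p => npair 10 (form_enc p)
  end.

Fixpoint list_enc (l : list nat) : nat :=
  match l with
  | [] => npair 0 0
  | n :: l => npair 1 (npair n (list_enc l))
  end.

Fixpoint code_enc (c : code) : nat :=
  match c with
  | Nil => npair 0 0
  | Base k d => npair 1 (npair k (code_enc d))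
  | Push p q l c d =>
      npair 2 (npair (form_enc p) (npair (form_enc q)
        (npair (list_enc l) (npair (code_enc c) (code_enc d)))))
  end.

Ltac npair_split :=
  repeat match goal with
  | H : npair _ _ = npair _ _ |- _ =>
      apply npair_inj in H; let H1 := fresh in destruct H as [H1 H]
  end.

Lemma term_enc_inj a : forall b, term_enc a = term_enc b -> a = b.
Proof.
  induction a; intros [] H; simpl in H; npair_split; try discriminate; f_equal; auto.
Qed.

Lemma form_enc_inj p : forall q, form_enc p = form_enc q -> p = q.
Proof.
  induction p; intros [] H; simpl in H; npair_split; try discriminate;
    f_equal; auto using term_enc_inj.
Qed.

Lemma list_enc_inj l : forall l', list_enc l = list_enc l' -> l = l'.
Proof.
  induction l; intros [] H; simpl in H; npair_split; try discriminate; f_equal; auto.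
Qed.

Lemma code_enc_inj c : forall d, code_enc c = code_enc d -> c = d.
Proof.
  induction c; intros [] H; simpl in H; npair_split; try discriminate;
    f_equal; auto using form_enc_inj, list_enc_inj.
Qed.

(** An inverse of [code_enc] obtained by choice: it enumerates all codes, so that each gets a stage
    of the construction. *)
Definition code_of (n : nat) : code := epsilon (inhabits Nil) (fun c => code_enc c = n).

Lemma code_of_enc c : code_of (code_enc c) = c.
Proof.
  apply code_enc_inj; unfold code_of.
  apply (epsilon_spec (inhabits Nil) (fun d => code_enc d = code_enc c)); now exists c.
Qed.

(** * The generic partial order *)

Definition po (R : rel) : Prop :=
  (forall x, R x x) /\ (forall x y, R x y -> R y x -> x = y) /\
  (forall x y z, R x y -> R y z -> R x z).

(* Promises about elements from [bnd] on: they lie below [ups] and above [downs];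
   [inert], which contains the even numbers, is an antichain of [ord]. *)
Record cond : Type := Cond
  { ord : rel; bnd : nat; ups : nset; downs : nset; inert : nset }.

(** The last two clauses exclude comparabilities forced by the promises: an inert element below a
    member of [downs] would lie below all later even numbers, and dually for [ups]. *)
Definition consistent (s : cond) : Prop :=
  po (ord s) /\
  (forall x, Nat.even x = true -> inert s x) /\
  (forall x, bnd s <= x -> inert s x -> Nat.even x = true) /\
  (forall x y, inert s x -> inert s y -> ord s x y -> x = y) /\
  (forall u, ups s u -> u < bnd s) /\
  (forall d, downs s d -> d < bnd s) /\
  (forall d u, downs s d -> ups s u -> ord s d u /\ d <> u) /\
  (forall k d, inert s k -> downs s d -> ~ ord s k d) /\
  (forall k u, inert s k -> ups s u -> ~ ord s u k).

Definition obeys (s : cond) : Prop :=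
  forall y, bnd s <= y ->
    (forall d, downs s d -> ord s d y) /\ (forall u, ups s u -> ord s y u).

Definition with_ord (s : cond) (R : rel) : cond :=
  Cond R (bnd s) (ups s) (downs s) (inert s).

(* Keeps the order below [bnd s] and places each later element as freely as the
   promises [ups s] and [downs s] allow. *)
Definition refresh_rel (s : cond) : rel := fun x y =>
  match le_lt_dec (bnd s) x, le_lt_dec (bnd s) y with
  | left _, left _ => x = y
  | left _, right _ => exists u, ups s u /\ ord s u y
  | right _, left _ => exists d, downs s d /\ ord s x d
  | right _, right _ => ord s x y
  end.

Definition refresh (s : cond) : cond := with_ord s (refresh_rel s).

Lemma agree_refresh s : agree (bnd s) (ord s) (ord (refresh s)).
Proof.
  intros x y Hx Hy; simpl; unfold refresh_rel.
  destruct (le_lt_dec (bnd s) x), (le_lt_dec (bnd s) y); try lia; reflexivity.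
Qed.

(** New elements go, pairwise incomparable, into the cut between [downs] and [ups]. No member of
    [ups] lies below a member of [downs], so no cycle arises. *)
Lemma refresh_correct s : consistent s -> consistent (refresh s) /\ obeys (refresh s).
Proof.
  intros ((Rr & Ra & Rt) & Kev & Kfr & Kac & Ub & Db & DU & KD & KU).
  assert (UD : forall d u, downs s d -> ups s u -> ~ ord s u d).
  { intros d u Hd Hu H; destruct (DU d u Hd Hu) as [H1 H2]; apply H2, Ra; auto. }
  split; [repeat split|]; simpl; unfold refresh_rel; simpl.
  - intros x; destruct (le_lt_dec (bnd s) x); auto.
  - intros x y; destruct (le_lt_dec (bnd s) x), (le_lt_dec (bnd s) y); auto.
    + intros (u & Hu & H1) (d & Hd & H2); exfalso; apply (UD d u); eauto.
    + intros (d & Hd & H2) (u & Hu & H1); exfalso; apply (UD d u); eauto.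
  - intros x y z;
      destruct (le_lt_dec (bnd s) x), (le_lt_dec (bnd s) y), (le_lt_dec (bnd s) z).
    + congruence.
    + now intros ->.
    + intros (u & Hu & H1) (d & Hd & H2); exfalso; apply (UD d u); eauto.
    + intros (u & Hu & H1) H2; eauto.
    + intros H1 <-; auto.
    (* Passing through a new element relates nothing new among the old ones, because [d] is already
       below [u]. *)
    + intros (d & Hd & H1) (u & Hu & H2).
      apply Rt with d; auto; apply Rt with u; auto; now apply DU.
    + intros H1 (d & Hd & H2); eauto.
    + eauto.
  - exact Kev.
  - exact Kfr.
  - intros x y Kx Ky; destruct (le_lt_dec (bnd s) x), (le_lt_dec (bnd s) y); auto.
    + intros (u & Hu & H); exfalso; apply (KU y u); auto.
    + intros (d & Hd & H); exfalso; apply (KD x d); auto.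
  - exact Ub.
  - exact Db.
  - specialize (Ub _ H0); specialize (Db _ H).
    destruct (le_lt_dec (bnd s) d), (le_lt_dec (bnd s) u); try lia; now apply DU.
  - now apply DU.
  - intros k d Kk Hd; specialize (Db _ Hd).
    destruct (le_lt_dec (bnd s) k), (le_lt_dec (bnd s) d); try lia; auto.
    intros (u & Hu & H); now apply (UD d u).
  - intros k u Kk Hu; specialize (Ub _ Hu).
    destruct (le_lt_dec (bnd s) u), (le_lt_dec (bnd s) k); try lia; auto.
    intros (d & Hd & H); now apply (UD d u).
  - intros y Hy; simpl in *; unfold refresh_rel; split.
    + intros d Hd; specialize (Db _ Hd).
      destruct (le_lt_dec (bnd s) d), (le_lt_dec (bnd s) y); try lia; eauto.
    + intros u Hu; specialize (Ub _ Hu).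
      destruct (le_lt_dec (bnd s) u), (le_lt_dec (bnd s) y); try lia; eauto.
Qed.

(** * Extending a condition to decide one code *)

Definition ext (s t : cond) : Prop :=
  bnd s < bnd t /\ agree (bnd s) (ord s) (ord t) /\
  (forall x, ups s x -> ups t x) /\ (forall x, downs s x -> downs t x) /\
  (forall x, inert s x -> inert t x) /\
  obeys (with_ord s (ord t)).

(** Convergence of [c] at [b] with answer [v] and use [N], expressed as invariance under all changes
    of [R] beyond [N] that keep [c] good. *)
Definition determines (c : code) (R : rel) (N b : nat) (v : bool) : Prop :=
  forall R', agree N R R' -> good R' c -> (get 0 R' c b <-> v = true).

(* Either [c] has converged at some [b], and all later elements are placed so as
   to follow its answer, or no order obeying [t] makes [c] converge at [b]. *)
Definition decided (c : code) (t : cond) : Prop :=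
  exists b,
    (exists v, determines c (ord t) (bnd t) b v /\
       if v : bool then ups t b else downs t b) \/
    (forall R N v, consistent (with_ord t R) -> obeys (with_ord t R) ->
       agree (bnd t) (ord t) R -> bnd t <= N -> ~ determines c R N b v).

Lemma step (s : cond) (c : code) : consistent s ->
  exists t, consistent t /\ obeys t /\ ext s t /\ decided c t.
Proof.
  intros Cs.
  (* Being odd and at least [bnd s], this element is not inert in [s]. *)
  set (b := 2 * bnd s + 1).
  assert (Hb : bnd s <= b) by lia.
  assert (Ob : Nat.even b = false) by (unfold b; now rewrite Nat.even_add, Nat.even_mul).
  clearbody b.
  destruct (refresh_correct s Cs) as [C1 O1].
  (* Making [b] inert keeps it incomparable to all even numbers in every order considered in the
     search below. *)
  set (s1 := Cond (refresh_rel s) (S b) (ups s) (downs s)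
    (fun x => inert s x \/ x = b)).
  assert (Cs1 : consistent s1).
  { destruct C1 as (P & Kev & Kfr & Kac & Ub & Db & DU & KD & KU); simpl in *.
    assert (Kb : forall x, inert s x -> refresh_rel s x b -> x = b).
    { intros x Kx; unfold refresh_rel.
      destruct (le_lt_dec (bnd s) x), (le_lt_dec (bnd s) b); try lia.
      intros (d & Hd & H); exfalso.
      destruct Cs as (_ & _ & _ & _ & _ & _ & _ & KD' & _); now apply (KD' x d). }
    assert (bK : forall x, inert s x -> refresh_rel s b x -> b = x).
    { intros x Kx; unfold refresh_rel.
      destruct (le_lt_dec (bnd s) x), (le_lt_dec (bnd s) b); try lia.
      intros (u & Hu & H); exfalso.
      destruct Cs as (_ & _ & _ & _ & _ & _ & _ & _ & KU'); now apply (KU' x u). }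
    unfold s1, consistent; simpl.
    split; [exact P|]. split; [auto|]. split.
    { intros x Hx [Kx | ->]; [apply Kfr; auto; lia | lia]. }
    split.
    { intros x y [Kx | ->] [Ky | ->]; auto. }
    split; [intros u Hu; specialize (Ub u Hu); lia|].
    split; [intros d Hd; specialize (Db d Hd); lia|].
    split; [exact DU|].
    destruct P as (_ & Ra & _).
    split.
    - intros k d [Kk | ->] Hd; auto; intros H.
      assert (d = b) by (apply Ra; auto; now apply (O1 b)).
      specialize (Db d Hd); lia.
    - intros k u [Kk | ->] Hu; auto; intros H.
      assert (u = b) by (apply Ra; auto; now apply (O1 b)).
      specialize (Ub u Hu); lia. }
  assert (Os1 : obeys s1).
  { intros y Hy; apply O1; simpl in *; lia. }
  assert (E1 : ext s s1).
  { unfold ext; simpl; split; [lia|]; split; [apply agree_refresh|].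
    do 3 (split; [solve [auto]|]); exact O1. }
  destruct (classic (exists R N v, consistent (with_ord s1 R) /\ obeys (with_ord s1 R) /\
    agree (S b) (ord s1) R /\ S b <= N /\ determines c R N b v))
    as [(R & N & v & CR & OR & AR & HN & DR) | Hno].
  (* Now [b] stops being inert and bounds the later elements. This is safe: [R] keeps the inert set
     of [s1] an antichain, so [b] is incomparable to everything inert in [s]. *)
  - set (t := Cond R N (fun x => ups s x \/ v = true /\ x = b)
      (fun x => downs s x \/ v = false /\ x = b) (inert s)).
    assert (Ct : consistent t).
    { destruct CR as (P & Kev & Kfr & Kac & Ub & Db & DU & KD & KU); simpl in *.
      destruct Cs as (_ & Kev' & Kfr' & _ & Ub' & Db' & _).
      assert (Bd : forall d, downs s d -> R d b /\ d <> b).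
      { intros d Hd; specialize (Db' d Hd); split; [|lia].
        apply AR; [lia | lia | apply (O1 b Hb)]; auto. }
      assert (Bu : forall u, ups s u -> R b u /\ b <> u).
      { intros u Hu; specialize (Ub' u Hu); split; [|lia].
        apply AR; [lia | lia | apply (O1 b Hb)]; auto. }
      assert (Kb : ~ inert s b).
      { intros H; apply Kfr' in H; congruence. }
      unfold t, consistent; simpl.
      split; [exact P|]. split; [exact Kev'|]. split.
      { intros x Hx Kx; apply Kfr; auto; lia. }
      split; [intros x y Kx Ky; auto|].
      split; [intros u [Hu | [_ ->]]; [specialize (Ub' u Hu)|]; lia|].
      split; [intros d [Hd | [_ ->]]; [specialize (Db' d Hd)|]; lia|].
      split.
      { intros d u [Hd | [Ev ->]] [Hu | [Ev' ->]]; auto; congruence. }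
      split.
      - intros k d Kk [Hd | [_ ->]]; auto; intros H.
        apply Kb; rewrite <- (Kac k b); auto.
      - intros k u Kk [Hu | [_ ->]]; auto; intros H.
        apply Kb; rewrite (Kac b k); auto. }
    (* From [N] on, [R] need not respect the new promise about [b]. Refreshing repairs this and
       keeps the part below [N], which fixes the answer. *)
    destruct (refresh_correct t Ct) as [C2 O2].
    assert (A2 := agree_refresh t).
    exists (refresh t); split; [assumption|]; split; [assumption|]; split.
    + destruct E1 as (H1 & H2 & _); unfold ext; simpl; split; [lia|]; split.
      { apply agree_trans with (1 := H2).
        apply agree_trans with R; [apply agree_le with (2 := AR); lia|].
        apply agree_le with (2 := A2); simpl; lia. }
      do 3 (split; [solve [auto]|]).
      (* The promises of [s1] bind [R] only from [S b] on; the elements from [bnd s] to [b] were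
         placed by the first refresh. *)
      assert (OsR : obeys (with_ord s R)).
      { intros y Hy; simpl in Hy; destruct (le_lt_dec (S b) y) as [L|L].
        - exact (OR y L).
        - destruct Cs as (_ & _ & _ & _ & Ub & Db & _), (O1 y Hy) as [Od Ou].
          split; intros z Hz; [specialize (Db z Hz) | specialize (Ub z Hz)];
            (apply AR; simpl in *; [lia | lia |]); [exact (Od z Hz) | exact (Ou z Hz)]. }
      intros y Hy; simpl in Hy; destruct (le_lt_dec N y) as [L|L].
      * destruct (O2 y L) as [Od Ou]; split; intros z Hz; [apply Od | apply Ou]; simpl; auto.
      * destruct Cs as (_ & _ & _ & _ & Ub & Db & _), (OsR y Hy) as [Od Ou].
        split; intros z Hz; [specialize (Db z Hz) | specialize (Ub z Hz)];
            (apply A2; simpl in *; [lia | lia |]); [exact (Od z Hz) | exact (Ou z Hz)].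
    + exists b; left; exists v; split.
      * intros R' HR'; apply DR; apply agree_trans with (2 := HR'); apply A2.
      * destruct v; simpl; auto.
  - exists s1; split; [assumption|]; split; [assumption|]; split; [assumption|].
    exists b; right; intros R N v H1 H2 H3 H4 H5; apply Hno.
    exists R, N, v; auto.
Qed.

(** * The generic sequence and its limit order *)

Definition start : cond :=
  Cond eq 0 (fun _ => False) (fun _ => False) (fun x => Nat.even x = true).

(** Iterates [step], treating [code_of e] at stage [e]; the subset type carries the invariants
    through the recursion. *)
Lemma generic_sequence : exists s : nat -> cond, forall e,
  consistent (s e) /\ obeys (s e) /\ ext (s e) (s (S e)) /\
  decided (code_of e) (s (S e)).
Proof.
  destruct (choice (fun (a : nat * {s : cond | consistent s /\ obeys s})
      (t : {s : cond | consistent s /\ obeys s}) =>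
      ext (proj1_sig (snd a)) (proj1_sig t) /\
      decided (code_of (fst a)) (proj1_sig t))) as [f Hf].
  { intros [e [s [Cs Os]]].
    destruct (step s (code_of e) Cs) as (t & Ct & Ot & H).
    exists (exist _ t (conj Ct Ot)); exact H. }
  assert (Hs : consistent start /\ obeys start).
  { split; [repeat split|]; simpl; try congruence; try contradiction.
    intros y _; split; contradiction. }
  set (g := nat_rect (fun _ => {s : cond | consistent s /\ obeys s})
    (exist _ start Hs) (fun e t => f (e, t))).
  exists (fun e => proj1_sig (g e)); intros e.
  destruct (proj2_sig (g e)); repeat (split; [assumption|]); apply (Hf (e, g e)).
Qed.

(** For the model: the value of a computable set at a single [b] tells on which side of [b] all late
    elements lie. *)
Lemma generic_order : exists R : rel, po R /\
  (forall x y, Nat.even x = true -> Nat.even y = true -> R x y -> x = y) /\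
  forall c, good R c -> exists b N v, (get 0 R c b <-> v = true) /\
    forall y, N <= y -> if v : bool then R y b else R b y.
Proof.
  destruct generic_sequence as [s Hs].
  assert (mono : forall e k, bnd (s e) + k <= bnd (s (k + e)) /\
    agree (bnd (s e)) (ord (s e)) (ord (s (k + e))) /\
    (forall x, ups (s e) x -> ups (s (k + e)) x) /\
    (forall x, downs (s e) x -> downs (s (k + e)) x) /\
    (forall x, inert (s e) x -> inert (s (k + e)) x) /\
    obeys (with_ord (s e) (ord (s (k + e))))).
  { intros e k; induction k as [|k (H1 & H2 & H3 & H4 & H5 & H6)].
    - simpl; split; [lia|]; split; [intros x y _ _; reflexivity|].
      do 3 (split; [solve [auto]|]); apply Hs.
    - destruct (Hs (k + e)) as (_ & _ & (G1 & G2 & G3 & G4 & G5 & G6) & _).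
      simpl; split; [lia|]; split.
      { apply agree_trans with (1 := H2); apply agree_le with (2 := G2); lia. }
      do 3 (split; [solve [auto]|]).
      (* Elements below the previous bound keep their placement; the others obey the promises
         inherited by the previous stage. *)
      intros y Hy; simpl in Hy; destruct (le_lt_dec (bnd (s (k + e))) y) as [L|L].
      + destruct (G6 y L) as [Od Ou]; split; intros z Hz; [apply Od | apply Ou]; simpl; auto.
      + destruct (Hs e) as ((_ & _ & _ & _ & Ub & Db & _) & _), (H6 y Hy) as [Od Ou].
        split; intros z Hz; [specialize (Db z Hz) | specialize (Ub z Hz)];
            (apply G2; simpl in *; [lia | lia |]); [exact (Od z Hz) | exact (Ou z Hz)]. }
  (* Bounds grow strictly, so at this stage the bound exceeds [x] and [y] and their relation is
     final. *)
  set (R := fun x y => ord (s (S (max x y))) x y).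
  assert (AR : forall e, agree (bnd (s e)) (ord (s e)) R).
  { intros e x y Hx Hy; unfold R.
    destruct (le_lt_dec e (S (max x y))) as [L|L].
    - destruct (mono e (S (max x y) - e)) as (_ & H & _).
      replace (S (max x y) - e + e) with (S (max x y)) in H by lia; auto.
    - destruct (mono (S (max x y)) (e - S (max x y))) as (_ & H & _).
      replace (e - S (max x y) + S (max x y)) with e in H by lia.
      destruct (mono 0 (S (max x y))) as (H0 & _).
      rewrite Nat.add_0_r in H0; symmetry; apply H; lia. }
  (* every property of finitely many elements of R is read off a late stage *)
  assert (late : forall e m, exists e', consistent (s e') /\ obeys (s e') /\
    m < bnd (s e') /\ agree (S m) (ord (s e')) R /\ bnd (s e) <= bnd (s e') /\
    (forall x, ups (s e) x -> ups (s e') x) /\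
    (forall x, downs (s e) x -> downs (s e') x) /\
    (forall x, inert (s e) x -> inert (s e') x) /\
    obeys (with_ord (s e) (ord (s e')))).
  { intros e m; exists (S m + e).
    destruct (mono e (S m)) as (H1 & _ & H2), (Hs (S m + e)) as (C & O & _).
    repeat (split; [first [assumption | lia]|]).
    split; [apply agree_le with (2 := AR (S m + e)); lia|].
    split; [lia | exact H2]. }
  (* [CR] and [OR] make [R] itself one of the orders that the second alternative of [decided] speaks
     about. *)
  assert (CR : forall e, consistent (with_ord (s e) R)).
  { intros e; destruct (Hs e) as ((_ & Kev & Kfr & _ & Ub & Db & _) & _).
    unfold consistent, with_ord; simpl; split; [repeat split|].
    - intros x; destruct (late e x) as (e' & ((Rr & _) & _) & _ & _ & A & _).
      apply A; auto.
    - intros x y; destruct (late e (max x y)) as (e' & ((_ & Ra & _) & _) & _ & _ & A & _).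
      intros H1 H2; apply Ra; apply A; auto; lia.
    - intros x y z; destruct (late e (max x (max y z)))
        as (e' & ((_ & _ & Rt) & _) & _ & _ & A & _).
      intros H1 H2; apply A; [lia | lia |]; apply Rt with y; apply A; auto; lia.
    - do 2 (split; [assumption|]); split; [|do 2 (split; [assumption|]); repeat split].
      + intros x y Kx Ky H; destruct (late e (max x y))
          as (e' & (_ & _ & _ & Kac & _) & _ & _ & A & _ & _ & _ & Km & _).
        apply Kac; auto; apply A; auto; lia.
      + destruct (late e (max d u))
          as (e' & (_ & _ & _ & _ & _ & _ & DU & _) & _ & _ & A & _ & Um & Dm & _).
        apply A; [lia | lia |]; apply DU; auto.
      + destruct (late e (max d u))
          as (e' & (_ & _ & _ & _ & _ & _ & DU & _) & _ & _ & A & _ & Um & Dm & _).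
        apply DU; auto.
      + intros k d Kk Hd H; destruct (late e (max k d))
          as (e' & (_ & _ & _ & _ & _ & _ & _ & KD & _) & _ & _ & A & _ & Um & Dm & Km & _).
        apply (KD k d); auto; apply A; auto; lia.
      + intros k u Kk Hu H; destruct (late e (max k u))
          as (e' & (_ & _ & _ & _ & _ & _ & _ & _ & KU) & _ & _ & A & _ & Um & Dm & Km & _).
        apply (KU k u); auto; apply A; auto; lia. }
  assert (OR : forall e, obeys (with_ord (s e) R)).
  { intros e y Hy; simpl in Hy.
    destruct (Hs e) as ((_ & _ & _ & _ & Ub & Db & _) & _).
    destruct (late e y) as (e' & _ & _ & _ & A & _ & _ & _ & _ & O).
    destruct (O y Hy) as [Od Ou]; split; intros z Hz; [specialize (Db z Hz) | specialize (Ub z Hz)];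
            (apply A; simpl in *; [lia | lia |]); [exact (Od z Hz) | exact (Ou z Hz)]. }
  exists R; split; [apply (CR 0)|]; split.
  { intros x y Hx Hy; destruct (CR 0) as (_ & Kev & _ & Kac & _); simpl in *; auto. }
  intros c gc.
  destruct (Hs (code_enc c)) as (_ & _ & _ & Dc); rewrite code_of_enc in Dc.
  set (t := s (S (code_enc c))) in *.
  destruct Dc as [b [(v & D & P) | Hno]].
  - exists b, (bnd t), v; split; [apply D; auto; apply AR|].
    intros y Hy; destruct (OR (S (code_enc c)) y Hy) as [Od Ou]; simpl in *.
    destruct v; auto.
  (* By finite use, a code good for [R] has its answer at [b] fixed by a finite part of [R], so
     divergence at [b] is impossible. *)
  - exfalso; destruct (get_locally c R gc 0 b) as [N HN].
    destruct (classic (get 0 R c b)) as [T|F].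
    + apply (Hno R (max (bnd t) N) true (CR _) (OR _) (AR _)); [lia|].
      intros R' A g; rewrite (HN R'); [tauto | | auto].
      apply agree_le with (2 := A); lia.
    + apply (Hno R (max (bnd t) N) false (CR _) (OR _) (AR _)); [lia|].
      intros R' A g; rewrite (HN R'); [|apply agree_le with (2 := A); lia | auto].
      split; [contradiction | discriminate].
Qed.

(** * The model *)

Definition computable (R : rel) (X : nset) : Prop :=
  exists c, good R c /\ X = get 0 R c.

(** One code for the whole environment lets a formula with several set parameters become a single
    [Push]. *)
Definition env_computable (R : rel) (r : list nset) : Prop :=
  exists d, good R d /\ r = sem R d.

Lemma env_computable_cons R r X :
  env_computable R r -> computable R X -> env_computable R (X :: r).
Proof.
  intros (d & gd & ->) (c & gc & ->); destruct c as [|k c|p q l c c'].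
  (* The head of [Nil] is the default [full], which is also [base R 1]. *)
  - now exists (Base 1 d).
  - now exists (Base k d).
  - exists (Push p q l c d); simpl in *; tauto.
Qed.

Lemma env_computable_nth R r k : env_computable R r -> computable R (nth k r full).
Proof.
  intros (d & gd & ->); revert k.
  induction d as [|b d IH|p q l c _ d IH]; intros k.
  - exists Nil; now destruct k.
  - destruct k as [|k]; [now exists (Base b d) | now apply IH].
  - destruct k as [|k]; [now exists (Push p q l c d) | apply IH, gd].
Qed.

(** Induction holds because the numbers are standard. For comprehension the equivalent pair [p], [q]
    is itself a good code over the environment. *)
Lemma RCA0_valid R p l r :
  RCA0 p -> env_computable R r -> sat (computable R) l r p.
Proof.
  intros H Hr; destruct H as [| | | | | | | |p _|p q Hp Hq]; try (simpl; lia).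
  - intros [H0 HS] n; simpl in HS; induction n as [|n IH].
    + now apply sat_inst1 in H0.
    + specialize (HS n IH); revert HS; unfold succ_inst.
      rewrite (sat_sub1 _ _ _ _ (S n :: l)); [auto|].
      intros [|k]; simpl; [lia | reflexivity].
  - intros E; destruct Hr as (d & gd & ->).
    assert (Hp' : forall x, sat (computable R) (x :: l) (sem R d) p <->
      holds (x :: l) (sem R d) p).
    { destruct Hp as [p Hp]; intros x; simpl.
      split; intros [w Hw]; exists w; revert Hw; now apply sat_Delta00_indep. }
    assert (Hq' : forall x, sat (computable R) (x :: l) (sem R d) q <->
      holds (x :: l) (sem R d) q).
    { destruct Hq as [q Hq]; intros x; simpl.
      split; intros Hw w; generalize (Hw w); now apply sat_Delta00_indep. }
    exists (fun x => holds (x :: l) (sem R d) p); split.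
    + exists (Push p q l d Nil); split; [|reflexivity]; simpl.
      repeat (split; [assumption|]); split; [|auto].
      intros x; rewrite <- Hp', <- Hq'; apply E.
    + intros x; simpl; rewrite sat_shift2, Hp'; tauto.
Qed.

Theorem theorem5p13 :
  ~ proves RCA0 countable_intervals_imply_no_infinite_antichain.
Proof.
  destruct generic_order as (R & (Rr & Ra & Rt) & Aev & HR).
  intros D.
  apply (soundness (computable R) (env_computable R) RCA0) with (l := []) (e := []) in D.
  - assert (HB : forall k, computable R (base R k))
      by (intros k; now exists (Base k Nil)).
    refine (D (base R 1) (HB 1) (base R 0) (HB 0) (conj _ _) _); simpl.
    + split; [|split; [|split]].
      * intros z (x & y & -> & _); exists x, y; unfold full; auto.
      * intros x _; now apply relset_npr.
      * intros x y [H1 H2]; apply relset_npr in H1, H2; auto.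
      * intros x y z [H1 H2]; apply relset_npr in H1, H2; apply relset_npr; eauto.
    + exists (base R 3); split; [apply HB|].
      intros I (c & gc & ->) [_ HI].
      assert (down : forall x y, R x y -> get 0 R c y -> get 0 R c x).
      { intros x y Hxy Hy; apply (HI x y); split; auto; now apply relset_npr. }
      destruct (HR c gc) as (b & N & v & Hv & Hlater).
      destruct (eventually_constant_fincofin N v (get 0 R c)) as [n Hn].
      (* Late elements lie below [b] if [b] belongs to the interval and above [b] if not; downward
         closure settles both cases. *)
      { intros y Hy; specialize (Hlater y Hy); destruct v.
        - split; auto; intros _; apply (down y b); auto; now apply Hv.
        - split; [|discriminate]; intros H; apply Hv, (down b y); auto. }
      exists n; intros x; simpl.
      assert (E : get 0 R c x <-> exists x' n', npr x n = npr x' n' /\ fincofin n' x').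
      { rewrite Hn; split; [intros H; now exists x, n|].
        intros (x' & n' & E & H); apply npr_inj in E; destruct E; congruence. }
      exact (conj (proj1 E) (proj2 E)).
    + exists (base R 2); split; [apply HB|]; split; [split|].
      * intros x _; exact I.
      * intros x y (Hx & Hy & Hne); simpl in *.
        split; intros H; apply relset_npr in H; apply Hne; auto.
        symmetry; auto.
      * intros n; exists (2 * S n); split; [simpl; lia|].
        change (Nat.even (2 * S n) = true); now rewrite Nat.even_mul.
  - exact (env_computable_cons R).
  - exact (env_computable_nth R).
  - intros p l r; apply RCA0_valid.
  - now exists Nil.
  - constructor.
Qed.
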